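(* Let $R$ be a Dedekind domain. Then (the multiplicative semigroup of) $R$ is a semilattice of stratified extensions of groups.
   Context: For a semigroup $T$, $\mathrm{Base}(T) = \bigcap_{m>0} T^m$, where $T^m$ is the set of all products of $m$ elements of $T$. $T$ is a stratified extension of $\mathrm{Base}(T)$ if $\mathrm{Base}(T)\neq\emptyset$; so $T$ is a stratified extension of a group if $\mathrm{Base}(T)$ is non-empty and is a group under the multiplication of $T$. A semigroup $T$ is a semilattice of semigroups $T_\alpha$ ($\alpha\in Y$) if $Y$ is a semilattice (commutative semigroup of idempotents), $T$ is the disjoint union of the non-empty subsemigroups $T_\alpha$, and $T_\alpha T_\beta\subseteq T_{\alpha\beta}$ for all $\alpha,\beta\in Y$. It is a semilattice of stratified extensions of groups if moreover each $T_\alpha$ is a stratified extension of a group. *)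

(* Defs.v *)
From mathcomp Require Import all_boot all_algebra.
From mathcomp Require Import mathcomp_extra boolp classical_sets.
Set Implicit Arguments.
Unset Strict Implicit.
Unset Printing Implicit Defensive.
Import GRing.Theory.
Local Open Scope ring_scope.
Local Open Scope classical_set_scope.

Section Semigroups.
Variables (T : Type) (op : SemiGroup.law T).
Implicit Types A B G : set T.

Definition setop A B : set T := [set op x y | x in A & y in B].

Definition subsemigroup A : Prop := A !=set0 /\ setop A A `<=` A.

(* Index shift: [prods A n] is A^(n+1), the set of all products of n + 1
   elements of A, since a semigroup need not have an empty product. *)
Fixpoint prods A (n : nat) : set T :=
  if n is n'.+1 then setop (prods A n') A else A.

Definition Base A : set T := \bigcap_n prods A n.

Definition is_group G : Prop :=
  setop G G `<=` G /\
  exists e, [/\ G e,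
    forall x, G x -> op e x = x /\ op x e = x &
    forall x, G x -> exists2 y, G y & op y x = e /\ op x y = e].

Definition stratified_extension_of_group A : Prop :=
  Base A !=set0 /\ is_group (Base A).

Definition semilattice_of_stratified_extensions_of_groups : Prop :=
  exists (Y : Type) (meet : SemiGroup.com_law Y) (S : Y -> set T),
    [/\ idempotent_op meet,
        \bigcup_a S a = [set: T] /\ trivIset [set: Y] S,
        forall a, subsemigroup (S a),
        forall a b, setop (S a) (S b) `<=` S (meet a b) &
        forall a, stratified_extension_of_group (S a)].

End Semigroups.

Section Dedekind.
Variable R : idomainType.
Implicit Types I J P : set R.

(* Unlike [idealr_closed], this allows the unit ideal. *)
Definition is_ideal I : Prop :=
  [/\ I 0, forall x y, I x -> I y -> I (x + y) &
      forall a x, I x -> I (a * x)].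

Definition finitely_generated I : Prop :=
  exists (n : nat) (g : 'I_n -> R),
    I = [set x | exists c : 'I_n -> R, x = \sum_i c i * g i].

Definition noetherian : Prop := forall I, is_ideal I -> finitely_generated I.

Definition prime_ideal P : Prop :=
  [/\ is_ideal P, ~ P 1 & forall x y, P (x * y) -> P x \/ P y].

Definition maximal_ideal P : Prop :=
  [/\ is_ideal P, ~ P 1 &
      forall J, is_ideal J -> P `<=` J -> ~ J 1 -> J = P].

Definition integrally_closed : Prop :=
  forall z : {fraction R},
    integralOver (@tofrac R) z -> exists x : R, z = tofrac x.

(* Fields are Dedekind domains under this definition. *)
Definition dedekind_domain : Prop :=
  [/\ noetherian, integrally_closed &
      forall P, prime_ideal P -> P <> [set 0] -> maximal_ideal P].

End Dedekind.

(* Main.v *)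
(** A domain has only the idempotents 0 and 1, so the semilattice has just two
    elements: the units, and the nonunits, whose base turns out to be {0}.
    Since nonzero primes are maximal, R/I has finite length for every nonzero
    ideal I: by noetherian induction, if xy is in I with x and y outside I, an
    ascending chain above I is controlled by its images in the chains above
    I + (x) and (I : x). A product of n + 1 nonunits equal to x <> 0 yields a
    strict chain of length n + 1 above (x), hence n is bounded. *)
Require Import Defs.
From mathcomp Require Import all_boot all_algebra.
From mathcomp Require Import mathcomp_extra boolp classical_sets.
From mathcomp Require Import ring.
Set Implicit Arguments.
Unset Strict Implicit.
Unset Printing Implicit Defensive.
Import GRing.Theory.
Local Open Scope ring_scope.
Local Open Scope classical_set_scope.

Section Ideals.
Variable R : idomainType.
Implicit Types (I J : set R) (c : nat -> set R) (x y a : R).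

(** * Ideals, sums with a principal ideal, and quotients *)

Definition principal x : set R := [set z | exists r, z = r * x].
Definition adjoin I x : set R := [set z | exists2 i, I i & exists r, z = i + r * x].
Definition colon I x : set R := [set z | I (z * x)].

(** Inclusions may be equalities: the images of a strict chain under [adjoin] and [colon] can stall,
    yet must again be chains. *)
Definition ideal_chain c : Prop :=
  (forall i, is_ideal (c i)) /\ (forall i, c i `<=` c i.+1).

Lemma principal_ideal x : is_ideal (principal x).
Proof.
split=> [|_ _ [r ->] [s ->]|a _ [r ->]]; first by exists 0; rewrite mul0r.
- by exists (r + s); rewrite mulrDl.
- by exists (a * r); rewrite mulrA.
Qed.

Lemma mem_principal x : principal x x.
Proof. by exists 1; rewrite mul1r. Qed.

Lemma principal_sub I x : is_ideal I -> I x -> principal x `<=` I.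
Proof. by move=> [_ _ hM] Ix _ [r ->]; apply: hM. Qed.

Lemma adjoin_ideal I x : is_ideal I -> is_ideal (adjoin I x).
Proof.
move=> [h0 hD hM].
split=> [|_ _ [i Ii [r ->]] [j Ij [s ->]]|a _ [i Ii [r ->]]].
- by exists 0 => //; exists 0; rewrite mul0r addr0.
- by exists (i + j); [exact: hD | exists (r + s); ring].
- by exists (a * i); [exact: hM | exists (a * r); ring].
Qed.

Lemma sub_adjoin I x : I `<=` adjoin I x.
Proof. by move=> i Ii; exists i => //; exists 0; rewrite mul0r addr0. Qed.

Lemma mem_adjoin I x : is_ideal I -> adjoin I x x.
Proof. by case=> h0 _ _; exists 0 => //; exists 1; rewrite mul1r add0r. Qed.

Lemma adjoin_subset I J x : I `<=` J -> adjoin I x `<=` adjoin J x.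
Proof. by move=> IJ z [i /IJ Ji zE]; exists i. Qed.

Lemma colon_ideal I x : is_ideal I -> is_ideal (colon I x).
Proof.
move=> [h0 hD hM]; rewrite /colon; split=> [|y z /= Iy Iz|a y /= Iy].
- by rewrite /= mul0r.
- by rewrite mulrDl; apply: hD.
- by rewrite -mulrA; apply: hM.
Qed.

Lemma sub_colon I x : is_ideal I -> I `<=` colon I x.
Proof. by move=> [_ _ hM] i Ii; rewrite /colon /= mulrC; apply: hM. Qed.

Lemma colon_subset I J x : I `<=` J -> colon I x `<=` colon J x.
Proof. by move=> IJ z; apply: IJ. Qed.

(** Write z in J as i + r x with i in I. Then r x = z - i lies in J, so r is in (J : x) = (I : x),
    hence r x and z are in I. *)
Lemma adjoin_colon_eq I J x : is_ideal I -> is_ideal J -> I `<=` J ->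
  adjoin I x = adjoin J x -> colon I x = colon J x -> I = J.
Proof.
move=> [_ hID _] [_ hJD hJM] IJ eqA eqC; apply/seteqP; split=> // z Jz.
have [i Ii [r zE]] : adjoin I x z by rewrite eqA; apply: sub_adjoin.
rewrite zE; apply: hID => //.
suff : colon J x r by rewrite -eqC.
rewrite /colon /=.
have -> : r * x = z + (-1) * i by rewrite zE; ring.
by apply: hJD => //; apply/hJM/IJ.
Qed.

Lemma ideal1T I x : is_ideal I -> I 1 -> I x.
Proof. by move=> [_ _ hM] I1; rewrite -[x]mulr1; apply: hM. Qed.

(** * Ascending chains and noetherian induction *)

Lemma chain_sub c i j : ideal_chain c -> (i <= j)%N -> c i `<=` c j.
Proof.
move=> [_ cS] /subnK <-; elim: (j - i)%N => [|k IHk] //=.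
by rewrite addSn; apply: subset_trans (cS _).
Qed.

Lemma chain_union_ideal c : ideal_chain c -> is_ideal (\bigcup_i c i).
Proof.
move=> cC; have [cI _] := cC; split=> [|x y [i _ cx] [j _ cy]|a x [i _ cx]].
- by exists 0%N => //; case: (cI 0%N).
- exists (maxn i j) => //; have [_ hD _] := cI (maxn i j); apply: hD.
  + exact: (chain_sub cC (leq_maxl i j)).
  + exact: (chain_sub cC (leq_maxr i j)).
- by exists i => //; have [_ _ hM] := cI i; apply: hM.
Qed.

Lemma noetherian_chain c : noetherian R -> ideal_chain c ->
  exists n, c n.+1 `<=` c n.
Proof.
move=> noeR cC; have [cI _] := cC.
have [k [g gE]] := noeR _ (chain_union_ideal cC).
have /choice [m mP] : forall i, exists n, c n (g i).
  move=> i; suff [n _ cn] : (\bigcup_i c i) (g i) by exists n.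
  (* Kronecker delta coefficients exhibit [g i] as a member of the ideal it helps generate. *)
  rewrite gE; exists (fun j => (j == i)%:R).
  rewrite (bigD1 i) //= eqxx mul1r big1 ?addr0 // => j /negbTE ->.
  by rewrite mul0r.
(* At this stage the chain contains all the generators, hence the whole union. *)
exists (\max_i m i) => x cx.
have : (\bigcup_i c i) x by exists (\max_i m i).+1.
rewrite gE => -[r ->]; have [h0 hD hM] := cI (\max_i m i).
apply: big_ind => // i _; apply: hM.
exact: (chain_sub cC (leq_bigmax i) (mP i)).
Qed.

Lemma noetherian_ind (Q : set R -> Prop) : noetherian R ->
  (forall I, is_ideal I ->
     (forall J, is_ideal J -> I `<=` J -> ~ J `<=` I -> Q J) -> Q I) ->
  forall I, is_ideal I -> Q I.
Proof.
move=> noeR step I0 I0I; apply: contrapT => nQ0.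
pose bad I := is_ideal I /\ ~ Q I.
(* With [bad I] placed under the existential, choice gives a total [f]; iterating it from [I0] would
   produce a chain that never stabilises. *)
have /choice [f fP] : forall I, exists J,
    bad I -> [/\ bad J, I `<=` J & ~ J `<=` I].
  move=> I; apply: contrapT => /forallNP no.
  have [Ii nQ] : bad I.
    by apply: contrapT => nbad; apply: (no I) => /nbad.
  apply/nQ/step => // J Ji IJ nJI; apply: contrapT => nQJ.
  by apply: (no J).
pose c n := iter n f I0.
have cbad n : bad (c n) by elim: n => //= n /fP [].
have cC : ideal_chain c.
  by split=> i; [case: (cbad i) | case: (fP _ (cbad i))].
have [n] := noetherian_chain noeR cC.
by case: (fP _ (cbad n)).
Qed.

(** * Length of the quotient by an ideal *)

Definition chain_length c n : nat := (\sum_(i < n) `[< c i <> c i.+1 >])%N.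

(** This says that the module R/I has length at most N. *)
Definition length_le I N : Prop :=
  forall c n, ideal_chain c -> I `<=` c 0%N -> (chain_length c n <= N)%N.

(** By [adjoin_colon_eq], each strict step of c stays strict in at least one of the two image
    chains. *)
Lemma chain_length_adjoin_colon c x n : ideal_chain c ->
  (chain_length c n <= chain_length (fun i => adjoin (c i) x) n +
                       chain_length (fun i => colon (c i) x) n)%N.
Proof.
move=> [cI cS]; rewrite -big_split; apply: leq_sum => i _ /=.
case: asboolP => // ne; case: asboolP => // /contrapT eqA.
case: asboolP => // /contrapT eqC; case: ne.
exact: (adjoin_colon_eq (cI _) (cI _) (cS _) eqA eqC).
Qed.

Lemma length_le_adjoin_colon I x M N :
  length_le (adjoin I x) M -> length_le (colon I x) N -> length_le I (M + N).
Proof.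
move=> lM lN c n cC Ic; have [cI cS] := cC.
apply: leq_trans (chain_length_adjoin_colon x n cC) _; apply: leq_add.
- apply: lM; last exact: adjoin_subset.
  by split=> i; [apply: adjoin_ideal | apply: adjoin_subset].
- apply: lN; last exact: colon_subset.
  by split=> i; [apply: colon_ideal | apply: colon_subset].
Qed.

Lemma length_le_unit I : I 1 -> length_le I 0.
Proof.
move=> I1 c n cC Ic; rewrite leqn0 sum_nat_eq0; apply/forallP => i /=.
have c1 j : c j 1 by apply: (chain_sub cC (leq0n j)); apply: Ic.
rewrite eqb0; apply/asboolPn; rewrite notK.
by apply/seteqP; split=> z _; apply: ideal1T (c1 _); case: cC.
Qed.

(** Every proper member of the chain equals I, so the only possible strict step goes from I to R. *)
Lemma length_le_maximal I : maximal_ideal I -> length_le I 1.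
Proof.
move=> [_ _ maxI] c n cC Ic; have [cI cS] := cC.
have eqI i : ~ c i 1 -> c i = I.
  by apply: maxI => //; apply: subset_trans Ic _; apply: chain_sub.
(* The bound is sharpened for the induction: no strict step has occurred as long as [c n] is
   proper. *)
suff : (chain_length c n <= `[< c n 1%R >])%N.
  by move=> /leq_trans; apply; apply: leq_b1.
elim: n => [|n IHn]; first by rewrite /chain_length big_ord0.
rewrite /chain_length big_ord_recr /=.
case: (pselect (c n.+1 1)) => [c1'|nc1'].
  rewrite (asboolT c1'); case: (pselect (c n 1)) => [c1|nc1].
    have -> : c n = c n.+1 by apply/seteqP; split=> z _; apply: ideal1T.
    rewrite (asboolF (P := _ <> _)) ?addn0 //.
    exact: leq_trans IHn (leq_b1 _).
  move: IHn; rewrite (asboolF nc1) leqn0 => /eqP.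
  by rewrite /chain_length => ->; apply: leq_b1.
have nc1 : ~ c n 1 by move=> /cS.
rewrite (eqI _ nc1') (eqI _ nc1) (asboolF (P := _ <> _)) // addn0.
by move: IHn; rewrite (asboolF nc1) => /leq_trans; apply.
Qed.

Lemma finite_length I : noetherian R ->
  (forall P : set R, prime_ideal P -> P <> [set 0] -> maximal_ideal P) ->
  is_ideal I -> I <> [set 0] -> exists N, length_le I N.
Proof.
move=> noeR dim1; move: I.
apply: (noetherian_ind (Q := fun I => I <> [set 0] -> exists N, length_le I N)) => //.
move=> I Iideal IHI I0.
have [I1|nI1] := pselect (I 1); first by exists 0%N; apply: length_le_unit.
have [Ip|nIp] := pselect (prime_ideal I).
  by exists 1%N; apply/length_le_maximal/dim1.
have [x [y [Ixy nIx nIy]]] : exists x y, [/\ I (x * y), ~ I x & ~ I y].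
  apply: contrapT => no; apply: nIp; split=> // x y Ixy.
  apply: contrapT => /not_orP[nIx nIy]; apply: no.
  by exists x, y.
(* The induction hypothesis covers nonzero ideals only. *)
have nonzero J : I `<=` J -> J <> [set 0].
  move=> IJ J0; apply: I0; rewrite -J0; apply/seteqP; split=> //.
  by rewrite J0 => _ ->; case: Iideal.
(* Both ideals are strictly larger than I: x witnesses it for I + (x), and y for (I : x). *)
have sA := @sub_adjoin I x; have sC := @sub_colon I x Iideal.
have [|M lM] := IHI _ (adjoin_ideal x Iideal) sA _ (nonzero _ sA).
  by move=> /(_ x (mem_adjoin x Iideal)).
have [|N lN] := IHI _ (colon_ideal x Iideal) sC _ (nonzero _ sC).
  by move=> /(_ y) AI; apply/nIy/AI; rewrite /colon /= mulrC.
by exists (M + N)%N; apply: length_le_adjoin_colon lM lN.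
Qed.

(** * Bounding the number of nonunit factors *)

(** Putting (xa) in front of a chain above (x) adds a strict step: if x = r x a, cancelling x makes
    a a unit. *)
Lemma length_le_factor x a N : x * a != 0 -> a \isn't a GRing.unit ->
  length_le (principal (x * a)) N -> (0 < N)%N /\ length_le (principal x) N.-1.
Proof.
move=> xa0 aNU lN.
(* The strict bound yields both claims; positivity of N comes from a constant chain with no
   steps. *)
suff lS c n : ideal_chain c -> principal x `<=` c 0%N ->
    (chain_length c n < N)%N.
  have lS1 c n cC xc := lS c n cC xc.
  split=> [|c n cC xc].
    have xC : ideal_chain (fun=> principal x).
      by split=> _; [apply: principal_ideal | apply: subset_refl].
    exact: leq_ltn_trans (leq0n _) (lS _ 0%N xC (@subset_refl _ _)).
  by have := lS c n cC xc; case: (N).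
move=> [cI cS] xc.
pose d i := if i is j.+1 then c j else principal (x * a).
have cx : c 0%N x by apply/xc/mem_principal.
have dC : ideal_chain d.
  split=> -[|i] //=; first exact: principal_ideal.
  apply: principal_sub => //; rewrite mulrC.
  by have [_ _ hM] := cI 0%N; apply: hM.
have := lN d n.+1 dC (@subset_refl _ _).
rewrite /chain_length big_ord_recl /= (asboolT (P := _ <> _)) // => xaE.
have [r] : principal (x * a) x by rewrite xaE.
rewrite mulrCA -{1}[x]mulr1 => /mulfI ra1.
have x0 : x != 0 by apply: contraNneq xa0 => ->; rewrite mul0r.
by move/negP: aNU; apply; apply/unitrPr; exists r; rewrite mulrC -ra1.
Qed.

Lemma prods_nonunit_lt n x N :
  prods (@GRing.mul R : SemiGroup.law R) [set a | a \isn't a GRing.unit] n x ->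
  x != 0 -> length_le (principal x) N -> (n < N)%N.
Proof.
elim: n x N => [|n IHn] x N /=.
  (* Index 0 means one factor; reading x as 1 * x lets [length_le_factor] give 0 < N. *)
  move=> xNU x0; rewrite -[x]mul1r => /length_le_factor.
  by rewrite mul1r => /(_ x0 xNU) [].
move=> [y yP [a aNU] <-] ya0'; have ya0 : y * a != 0 := ya0'.
move=> /(length_le_factor ya0 aNU) [N0 lN].
have y0 : y != 0 by apply: contraNneq ya0 => ->; rewrite mul0r.
by rewrite -(prednK N0) ltnS; apply: IHn lN.
Qed.

End Ideals.

(** * The two bases and the decomposition *)

Lemma Base_nonunit (R : idomainType) : noetherian R ->
  (forall P : set R, prime_ideal P -> P <> [set 0] -> maximal_ideal P) ->
  Base (@GRing.mul R : SemiGroup.law R) [set a | a \isn't a GRing.unit] = [set 0].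
Proof.
move=> noeR dim1; apply/seteqP; split=> [x xB|_ -> n _].
  apply: contrapT => /eqP x0.
  have [|N lN] := finite_length noeR dim1 (principal_ideal x).
    by move=> xE; case/eqP: x0; have := mem_principal x; rewrite xE.
  (* Membership in the product set of index N itself would force N < N. *)
  by have := prods_nonunit_lt (xB N I) x0 lN; rewrite ltnn.
elim: n => [|n IHn] /=; first by rewrite unitr0.
by exists 0 => //; exists 0; rewrite /= ?unitr0 // mulr0.
Qed.

(** A unit is a product of any number of units, by padding with factors 1. *)
Lemma Base_unit (R : idomainType) :
  Base (@GRing.mul R : SemiGroup.law R) [set a | a \is a GRing.unit] =
  [set a | a \is a GRing.unit].
Proof.
apply/seteqP; split=> [x xB|x xU n _]; first exact: (xB 0%N I).
elim: n x xU => [|n IHn] x xU //=.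
by exists x; [exact: IHn | exists 1; rewrite /= ?unitr1 // mulr1].
Qed.

Theorem theorem3p3 (R : idomainType) (hR : dedekind_domain R) :
  semilattice_of_stratified_extensions_of_groups (@GRing.mul R : SemiGroup.law R).
Proof.
have [noeR _ dim1] := hR.
(* The components are the fibres of the unit test, which is multiplicative into [andb] because a
   product is a unit exactly when both factors are. *)
exists bool, (andb : SemiGroup.com_law bool),
  (fun b => [set a : R | (a \is a GRing.unit) = b]).
have SfE : [set a : R | (a \is a GRing.unit) = false] =
           [set a | a \isn't a GRing.unit].
  by apply/seteqP; split=> a /=; [move=> ->|move=> /negbTE ->].
have closed a b :
    setop (@GRing.mul R : SemiGroup.law R) [set z : R | (z \is a GRing.unit) = a]
      [set z : R | (z \is a GRing.unit) = b] `<=`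
    [set z : R | (z \is a GRing.unit) = a && b].
  by move=> _ [x <- [y <- <-]]; rewrite /= unitrM.
split=> //.
- by case.
- split; first by apply/seteqP; split=> // x _; exists (x \is a GRing.unit).
  by apply/trivIsetP => a b _ _ ab; apply/seteqP; split=> // x [/= xa xb];
     move/eqP: ab; rewrite -xa -xb.
- move=> b; split; last by have := closed b b; rewrite andbb.
  by case: b; [exists 1; rewrite /= unitr1 | exists 0; rewrite /= unitr0].
- case.
    rewrite /stratified_extension_of_group Base_unit; split.
      by exists 1; rewrite /= unitr1.
    split; first by move=> _ [x xU [y yU <-]]; rewrite /= unitrM xU.
    exists 1; split=> [|x _|x xU] /=; first exact: unitr1.
    + by rewrite mul1r mulr1.
    + by exists x^-1; rewrite /= ?unitrV ?mulVr ?mulrV.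
  rewrite SfE /stratified_extension_of_group Base_nonunit //; split.
    by exists 0.
  split; first by move=> _ [_ -> [_ -> <-]]; rewrite /= mulr0.
  (* In the trivial group {0}, the identity is 0, which is its own inverse. *)
  exists 0; split=> // _ ->; first by rewrite /= mulr0.
  by exists 0 => //=; rewrite mulr0.
Qed.
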